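(* Let $f:\mathbb{R}\to\mathbb{R}$ be analytic with $f(x)=\sum_{z\ge0}a_zx^z$, let $x^*$ be a fixed point of $dx/dt=f(x)$, i.e. $f(x^* )=0$, and let $\alpha\ge0$. Consider the system on $\mathbb{R}^N$ $$\frac{d\vec X}{dt}=\boldsymbol{\Omega}_1\boldsymbol{F}(\vec X)\vec 1-\alpha(\boldsymbol{I}-\boldsymbol{\Omega}_1)\vec X ,$$ where $\boldsymbol{F}$ is either the standard commutative map $\boldsymbol{F}(\vec X)=\sum_{z}a_z\boldsymbol{X}^z$ or the standard non-commutative map $\boldsymbol{F}(\vec X)=\sum_za_z(\boldsymbol{\Omega}_1\boldsymbol{X})^z$. For both maps, the Jacobian of the right-hand side at the fixed point $\vec X^*=x^*\vec 1$ is $$J_{ir}(\vec X^* )=-\alpha\delta_{ir}+\frac1N\big(f'(x^* )+\alpha\big),\qquad\text{i.e.}\qquad \boldsymbol{J}(\vec X^* )=-\alpha\boldsymbol{I}+\big(f'(x^* )+\alpha\big)\boldsymbol{\Omega}_1 .$$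
   Context: $\vec 1\in\mathbb{R}^N$ is the all-ones vector, $\boldsymbol{I}$ the identity, $\boldsymbol{\Omega}_1$ the $N\times N$ matrix with all entries $1/N$, $\boldsymbol{X}=\mathrm{diag}(X_1,\dots,X_N)$ for $\vec X=(X_1,\dots,X_N)$, and $\delta_{ir}$ the Kronecker symbol. A matrix to the power zero is the identity. The power series of $f$ is assumed to represent $f$ on all of $\mathbb{R}$. *)

(* Defs.v *)
From HB Require Import structures.
From mathcomp Require Import all_boot all_order all_algebra.
From mathcomp Require Import all_classical all_reals all_analysis.

Set Implicit Arguments.
Unset Strict Implicit.
Unset Printing Implicit Defensive.

Import Order.TTheory GRing.Theory Num.Theory.
Import numFieldNormedType.Exports.

Local Open Scope classical_set_scope.
Local Open Scope ring_scope.

Definition ones {R : realType} (N : nat) : 'cV[R]_N := const_mx 1.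

Definition Omega1 {R : realType} (N : nat) : 'M[R]_N := const_mx N%:R^-1.

Definition diag_of {R : realType} {N : nat} (X : 'cV[R]_N) : 'M[R]_N :=
  diag_mx X^T.

(* Sum of the series a_z M^z in the normed space of matrices, with M^0 = I.
   As [lim] is total, this is meaningful only when the series converges; it
   does for every M if the scalar series with coefficients a converges on all
   of R. *)
Definition mx_power_series {R : realType} {N : nat} (a : R^nat)
    (M : 'M[R]_N) : 'M[R]_N :=
  lim (series (fun z : nat => a z *: M ^+ z) @ \oo).

Definition commutative_map {R : realType} {N : nat} (a : R^nat)
    (X : 'cV[R]_N) : 'M[R]_N :=
  mx_power_series a (diag_of X).

Definition noncommutative_map {R : realType} {N : nat} (a : R^nat)
    (X : 'cV[R]_N) : 'M[R]_N :=
  mx_power_series a (Omega1 N *m diag_of X).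

Definition vector_field {R : realType} {N : nat} (F : 'cV[R]_N -> 'M[R]_N)
    (alpha : R) (X : 'cV[R]_N) : 'cV[R]_N :=
  Omega1 N *m F X *m ones N - alpha *: ((1%:M - Omega1 N) *m X).

(* Entry (i, r) is the partial derivative of the i-th component of G in the
   r-th coordinate.  The library's [jacobian] is for maps between row vectors
   and uses the transposed convention.  Derivatives are total functions, so
   existence has to be asserted separately, with [differentiable]. *)
Definition col_jacobian {R : realType} {N : nat} (G : 'cV[R]_N -> 'cV[R]_N)
    (p : 'cV[R]_N) : 'M[R]_N :=
  \matrix_(i, r) 'D_(delta_mx r 0) (fun X : 'cV[R]_N => G X i 0) p.

(* Main.v *)
(* Since Omega_1 v = mean(v) 1, the field only depends on F through mean(F(X) 1).
   A power series in M maps an eigenvector v of M with eigenvalue m to f(m) v.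
   In the commutative case 1 is the sum of the eigenvectors e_j of diag(X), so
   F(X) 1 = (f(X_j))_j; in the non-commutative case 1 is itself an eigenvector
   of Omega_1 diag(X), with eigenvalue mean(X), so F(X) 1 = f(mean(X)) 1.  At
   x* 1 the means of both have the differential v |-> f'(x* ) mean(v). *)
Require Import Defs.
From HB Require Import structures.
From mathcomp Require Import all_boot all_order all_algebra.
From mathcomp Require Import all_classical all_reals all_analysis.
From mathcomp Require Import ring.

Set Implicit Arguments.
Unset Strict Implicit.
Unset Printing Implicit Defensive.

Import Order.TTheory GRing.Theory Num.Theory.
Import numFieldNormedType.Exports.

Local Open Scope classical_set_scope.
Local Open Scope ring_scope.

(** * Entire scalar series, entry bounds for matrix powers, entrywise limits *)

Lemma is_cvg_pseries_norm (R : realType) (a : R^nat) (x : R) :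
  (forall y : R, cvgn (pseries a y)) -> 0 <= x ->
  cvgn (pseries (fun n => `|a n|) x).
Proof.
move=> cvg_a x0; apply: (@is_cvg_pseries_inside_norm _ a (x + 1)) => //.
by rewrite !ger0_norm ?ltrDl// addr_ge0.
Qed.

(** Domination: with [y = |x| + 1], the bounds [n+1 <= 2^(n+1)] and [|x|^n <= y^n <= y^(n+1)] put
    the n-th term below [|a_(n+1)| (2y)^(n+1)], a term of the absolutely convergent series at
    [2y]. *)
Lemma is_cvg_pseries_diffs (R : realType) (a : R^nat) :
  (forall y : R, cvgn (pseries a y)) ->
  forall x : R, cvgn (pseries (pseries_diffs a) x).
Proof.
move=> cvg_a x; pose y : R := `|x| + 1.
have y1 : 1 <= y by rewrite lerDr.
have y0 : 0 <= y := le_trans ler01 y1.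
pose v n := `|a n| * (2 * y) ^+ n.
have cv : cvgn (series v) by apply: is_cvg_pseries_norm => //; rewrite mulr_ge0.
have cv1 : cvgn (series (fun n => v n.+1)).
  have -> : series (fun n => v n.+1) = (fun n => series v n.+1 - v 0).
    apply/funext => n; rewrite /series/= [in RHS]big_nat_recl//=.
    by rewrite addrC addKr.
  apply/cvg_ex; exists (limn (series v) - v 0); apply: cvgB; last exact: cvg_cst.
  by rewrite cvg_shiftS.
apply: normed_cvg; apply: series_le_cvg cv1 => n /=.
- exact: normr_ge0.
- by rewrite mulr_ge0// exprn_ge0// mulr_ge0.
rewrite /v /pseries_diffs 2!normrM normr_nat normrX exprMn -mulrA mulrCA.
apply: ler_wpM2l => //; apply: ler_pM => //.
- by rewrite -natrX ler_nat ltnW// ltn_expl.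
rewrite (@le_trans _ _ (y ^+ n))//.
  by rewrite lerXn2r ?nnegrE// lerDl.
by rewrite exprS ler_peMl// exprn_ge0.
Qed.

(** The sum of all entry moduli serves as a crude norm: it bounds every row sum, so each further
    factor [M] costs at most one factor of it. *)
Lemma norm_expmx_entry (R : realType) (N : nat) (M : 'M[R]_N) (z : nat) (i j : 'I_N) :
  `|(M ^+ z) i j| <= (\sum_k \sum_l `|M k l|) ^+ z.
Proof.
have rowsum k : \sum_l `|M k l| <= \sum_k \sum_l `|M k l|.
  by rewrite [leRHS](bigD1 k)//= lerDl sumr_ge0// => ? _; exact: sumr_ge0.
elim: z i j => [|z IH] i j.
  by rewrite !expr0 mxE; case: eqP; rewrite ?normr1 ?normr0.
rewrite !exprS mxE; apply: le_trans (ler_norm_sum _ _ _) _.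
apply: (@le_trans _ _ (\sum_k `|M i k| * (\sum_k \sum_l `|M k l|) ^+ z)).
  by apply: ler_sum => k _; rewrite normrM ler_wpM2l.
rewrite -mulr_suml ler_wpM2r// exprn_ge0//.
by apply: sumr_ge0 => k _; exact: sumr_ge0.
Qed.

Lemma series_mxE (R : realType) (m n : nat) (u : ('M[R]_(m, n))^nat) (p : nat) i j :
  series u p i j = series (fun z => u z i j) p.
Proof. by rewrite /series/= summxE. Qed.

(** The matrix norm is a maximum over finitely many entries, and finitely many eventual conditions
    hold eventually together. *)
Lemma cvg_mx_entry (R : realType) (T : Type) (F : set_system T) {FF : Filter F}
    (m n : nat) (u : T -> 'M[R]_(m, n)) (L : 'M[R]_(m, n)) :
  (forall i j, (fun t => u t i j) @ F --> L i j) -> u @ F --> L.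
Proof.
move=> uL; apply/cvgrPdist_le => /= e e0; near=> t.
rewrite /Num.Def.normr/= mx_normrE (bigmax_le _ (ltW e0))//= => i _.
rewrite !mxE/=.
move: i; near: t; apply: filter_forall => /= i.
exact: ((cvgrPdist_le _ _).1 (uL i.1 i.2)).
Unshelve. all: by end_near. Qed.

(** * The mean of a vector and the averaging matrix *)

Definition mean {R : realType} {N : nat} (X : 'cV[R]_N) : R :=
  N%:R^-1 * \sum_j X j 0.

Lemma mean_delta (R : realType) (N : nat) (r : 'I_N) :
  mean (delta_mx r 0 : 'cV[R]_N) = N%:R^-1.
Proof.
rewrite /mean (bigD1 r)//= mxE !eqxx big1 ?addr0 ?mulr1// => j /negPf jr.
by rewrite mxE jr.
Qed.

Lemma mean_scale_ones (R : realType) (N : nat) (c : R) : (0 < N)%N ->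
  mean (c *: ones N) = c.
Proof.
move=> N0; rewrite /mean (eq_bigr (fun=> c)) => [|j _]; last by rewrite !mxE mulr1.
by rewrite sumr_const card_ord -[c *+ _]mulr_natl mulKf// pnatr_eq0 -lt0n.
Qed.

Lemma Omega1_mulmx (R : realType) (N : nat) (X : 'cV[R]_N) :
  Omega1 N *m X = mean X *: ones N.
Proof.
apply/matrixP => i j; rewrite !mxE ord1 mulr1 /mean mulr_sumr.
by apply: eq_bigr => k _; rewrite mxE.
Qed.

Lemma diag_of_ones (R : realType) (N : nat) (X : 'cV[R]_N) :
  diag_of X *m ones N = X.
Proof.
by apply/matrixP => i j; rewrite mul_diag_mx !mxE ord1 mulr1.
Qed.

(** * Entire power series of matrices and their action on [ones] *)

Section EntirePowerSeries.
Variables (R : realType) (a : R^nat).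
Hypothesis cvg_a : forall x : R, cvgn (pseries a x).

Lemma is_derive_limn_pseries (x : R) :
  is_derive x (1 : R) (fun y => limn (pseries a y))
    (limn (pseries (pseries_diffs a) x)).
Proof.
(* Termwise differentiation asks that the series and its first two formal derivatives converge at a
   point of modulus greater than [|x|]. *)
apply: (@pseries_snd_diffs _ _ (`|x| + 1)) => //.
- exact: is_cvg_pseries_diffs.
- by apply: is_cvg_pseries_diffs => y; exact: is_cvg_pseries_diffs.
- by rewrite [ltRHS]ger0_norm ?ltrDl// addr_ge0.
Qed.

(** Each entry is dominated by the scalar series of [|a_z| s^z], where [s] is the sum of the moduli
    of the entries of [M]. *)
Lemma is_cvg_mx_power_series (N : nat) (M : 'M[R]_N) :
  cvgn (series (fun z => a z *: M ^+ z)).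
Proof.
have ce i j : cvgn (fun p => series (fun z => a z *: M ^+ z) p i j).
  rewrite (_ : (fun p => _) = series (fun z => (a z *: M ^+ z) i j)); last first.
    by apply/funext => p; exact: series_mxE.
  apply: normed_cvg.
  apply: series_le_cvg (is_cvg_pseries_norm (x := \sum_k \sum_l `|M k l|) cvg_a _).
  - by move=> n /=.
  - move=> n /=; rewrite mulr_ge0// exprn_ge0//.
    by apply: sumr_ge0 => k _; exact: sumr_ge0.
  - move=> n /=; rewrite mxE normrM ler_wpM2l//.
    exact: norm_expmx_entry.
  - by apply: sumr_ge0 => k _; exact: sumr_ge0.
apply/cvg_ex; exists (\matrix_(i, j)
  limn (fun p => series (fun z => a z *: M ^+ z) p i j)).
by apply: cvg_mx_entry => i j; rewrite mxE; exact: ce.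
Qed.

Lemma mx_power_series_eigen (N : nat) (M : 'M[R]_N) (v : 'cV[R]_N) (m : R) :
  M *m v = m *: v ->
  mx_power_series a M *m v = limn (pseries a m) *: v.
Proof.
move=> Mv.
have Mzv z : M ^+ z *m v = m ^+ z *: v.
  elim: z => [|z IH]; first by rewrite !expr0 mul1mx scale1r.
  by rewrite !exprSr -mulmxA Mv -scalemxAr IH scalerA mulrC.
set S := series (fun z => a z *: M ^+ z).
(* Convergence is what makes the total [lim] in [mx_power_series] a genuine limit. *)
have SL : S @ \oo --> mx_power_series a M := @is_cvg_mx_power_series N M.
apply/matrixP => i k; rewrite !mxE.
(* The same sequence of entries gets two limits: [h1] by continuity of coordinates, [h2] through the
   eigenvalue relation. Uniqueness of limits equates them. *)
have h1 : (fun p => (S p *m v) i k) @ \oo -->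
    \sum_j mx_power_series a M i j * v j k.
  rewrite (_ : (fun p => _) = (fun p => \sum_j S p i j * v j k)); last first.
    by apply/funext => p; rewrite mxE.
  apply: cvg_big => [|j _]; first exact: add_continuous.
  apply: cvgMr_tmp.
  exact: (cvg_comp _ _ SL (@coord_continuous _ _ _ i j _)).
have h2 : (fun p => (S p *m v) i k) = (fun p => pseries a m p * v i k).
  apply/funext => p; rewrite /S /pseries /series/= mulmx_suml summxE mulr_suml.
  by apply: eq_bigr => z _; rewrite -scalemxAl Mzv scalerA !mxE.
move/(cvg_lim (@Rhausdorff R)) : h1 => <-; rewrite h2.
by apply: cvg_lim => //; apply: cvgMr_tmp; exact: cvg_a.
Qed.

Lemma commutative_map_ones (N : nat) (X : 'cV[R]_N) :
  commutative_map a X *m ones N = map_mx (fun x => limn (pseries a x)) X.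
Proof.
have onesE : ones N = \sum_j (delta_mx j 0 : 'cV[R]_N).
  apply/matrixP => i k; rewrite ord1 summxE mxE (bigD1 i)//= mxE !eqxx.
  by rewrite big1 ?addr0// => j /negPf ji; rewrite mxE eq_sym ji.
have eig j : diag_of X *m (delta_mx j 0 : 'cV_N) = X j 0 *: delta_mx j 0.
  apply/matrixP => i k; rewrite mul_diag_mx !mxE.
  by case: eqP => [->|]; rewrite ?mulr0.
rewrite onesE mulmx_sumr; under eq_bigr do rewrite (mx_power_series_eigen (eig _)).
apply/matrixP => i k; rewrite ord1 summxE mxE (bigD1 i)//= !mxE !eqxx mulr1.
by rewrite big1 ?addr0// => j /negPf ji; rewrite !mxE eq_sym ji mulr0.
Qed.

Lemma noncommutative_map_ones (N : nat) (X : 'cV[R]_N) :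
  noncommutative_map a X *m ones N = limn (pseries a (mean X)) *: ones N.
Proof.
apply: mx_power_series_eigen.
by rewrite -mulmxA diag_of_ones Omega1_mulmx.
Qed.

End EntirePowerSeries.

(** * Differentials of the mean, of its compositions with a scalar function, and of the field *)

Lemma is_diff_linear (R : realType) (V W : normedModType R) (l : V -> W) (x : V) :
  linear l -> continuous l -> is_diff x l l.
Proof.
move=> llin lcont.
pose lM := GRing.isLinear.Build _ _ _ _ _ llin.
pose L : {linear V -> W} := HB.pack l lM.
apply: DiffDef; first exact: (@linear_differentiable _ _ _ L).
exact: (@diff_lin _ _ _ L).
Qed.

Lemma is_diff_sum (R : realType) (V W : normedModType R) (n : nat)
    (h dh : 'I_n -> V -> W) (x : V) :
  (forall i, is_diff x (h i) (dh i)) ->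
  is_diff x (\sum_i h i) (\sum_i dh i).
Proof.
move=> hi; elim/big_ind2 : _ => //.
- exact: is_diff_cst.
- by move=> f df g dg ? ?; exact: is_diffD.
Qed.

Lemma is_diff_coord (R : realType) (m n : nat) (X : 'M[R]_(m, n)) i j :
  is_diff X (fun Y : 'M[R]_(m, n) => Y i j) (fun Y => Y i j).
Proof.
by apply: is_diff_linear; [move=> k u v; rewrite !mxE|exact: coord_continuous].
Qed.

Lemma is_diff_mean (R : realType) (N : nat) (X : 'cV[R]_N) :
  is_diff X (@mean R N) (@mean R N).
Proof.
have meanE : @mean R N = N%:R^-1 *: (\sum_j fun Y : 'cV[R]_N => Y j 0).
  by apply/funext => Y; rewrite /mean fctE fct_sumE.
rewrite meanE; apply: is_diffZ; apply: is_diff_sum => j.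
exact: is_diff_coord.
Qed.

Lemma is_diff_comp_derive1 (R : realType) (V : normedModType R) (f : R -> R)
    (g dg : V -> R) (x : V) : is_diff x g dg -> derivable f (g x) 1 ->
  is_diff x (f \o g) (fun v => derive1 f (g x) * dg v).
Proof.
move=> dgx /derivable1_diffP df.
have dff : is_diff (g x) f (fun h => h *: derive1 f (g x)).
  by apply: DiffDef => //; exact: diff1E.
by apply: is_diff_eq; apply/funext => v /=; rewrite mulrC.
Qed.

Lemma is_diff_mean_map (R : realType) (N : nat) (f : R -> R) (X : 'cV[R]_N) :
  (forall j, derivable f (X j 0) 1) ->
  is_diff X (fun Y => mean (map_mx f Y))
    (fun v => mean (\col_j (derive1 f (X j 0) * v j 0))).
Proof.
move=> dfX.
have dj j := is_diff_comp_derive1 (is_diff_coord X j 0) (dfX j).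
have := is_diffZ (N%:R^-1) (is_diff_sum dj).
congr (is_diff_def _ _ _); apply/funext => Y; rewrite /mean /=.
- rewrite fctE fct_sumE; congr (_ * _).
  by apply: eq_bigr => j _; rewrite mxE.
- rewrite fctE fct_sumE; congr (_ * _).
  by apply: eq_bigr => j _; rewrite mxE.
Qed.

Lemma is_diff_consensus (R : realType) (N : nat) (g dg : 'cV[R]_N -> R) (alpha : R)
    (X : 'cV[R]_N) : is_diff X g dg ->
  is_diff X (fun Y => g Y *: ones N - alpha *: (Y - mean Y *: ones N))
            (fun v => dg v *: ones N - alpha *: (v - mean v *: ones N)).
Proof.
move=> dgX.
have dm := is_diff_mean X.
(* Stated with operations on functions, so that the differentiation rules apply by inference; it is
   convertible to the pointwise goal. *)
have h : is_diff X (( *:%R ^~ (ones N)) \o g - alpha *: (id - (( *:%R ^~ (ones N)) \o mean)))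
   (( *:%R ^~ (ones N)) \o dg - alpha *: (id - (( *:%R ^~ (ones N)) \o mean))).
  by apply: is_diff_eq.
exact: h.
Qed.

(** Differentiability lets entries commute with directional derivatives, so column [r] is the
    differential at the r-th basis vector. *)
Lemma col_jacobianE (R : realType) (N : nat) (G dG : 'cV[R]_N -> 'cV[R]_N)
    (p : 'cV[R]_N) : is_diff p G dG ->
  col_jacobian G p = \matrix_(i, r) dG (delta_mx r 0) i 0.
Proof.
move=> dGp; apply/matrixP => i r; rewrite !mxE.
have -> : dG (delta_mx r 0) = 'D_(delta_mx r 0) G p.
  by rewrite deriveE ?diff_val.
by rewrite derive_mx ?mxE//; exact: diff_derivable.
Qed.

Theorem corollary3p9 (R : realType) (N : nat) (hN : (0 < N)%N)
    (f : R -> R) (a : R^nat)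
    (hf : forall x : R, pseries a x @ \oo --> f x)
    (xs : R) (hxs : f xs = 0)
    (alpha : R) (halpha : 0 <= alpha)
    (F : 'cV[R]_N -> 'M[R]_N)
    (hF : F = commutative_map a \/ F = noncommutative_map a) :
  let G := vector_field F alpha in
  let Xs : 'cV[R]_N := xs *: ones N in
  [/\ G Xs = 0,
      differentiable G Xs,
      (forall i r : 'I_N, col_jacobian G Xs i r =
         - alpha * (i == r)%:R + N%:R^-1 * (derive1 f xs + alpha)) &
      col_jacobian G Xs =
         - alpha *: 1%:M + (derive1 f xs + alpha) *: Omega1 N].
Proof.
have cvg_a x : cvgn (pseries a x) by apply/cvg_ex; exists (f x); exact: hf.
have fE : (fun x => limn (pseries a x)) = f.
  by apply/funext => x; apply: cvg_lim => //; exact: hf.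
have df x : derivable f x 1.
  by have [] := is_derive_limn_pseries cvg_a x; rewrite fE.
have mXs : mean (xs *: ones N) = xs by exact: mean_scale_ones.
(* From here on the two maps are indistinguishable: only the scalar [g] and its differential at the
   fixed point matter. *)
have [g [gE gXs dg]] : exists g : 'cV[R]_N -> R,
    [/\ forall X, mean (F X *m ones N) = g X, g (xs *: ones N) = 0 &
      is_diff (xs *: ones N) g (fun v => derive1 f xs * mean v)].
  case: hF => ->.
  - exists (fun X => mean (map_mx f X)); split.
    + by move=> X; rewrite commutative_map_ones// fE.
    + rewrite (_ : map_mx f _ = f xs *: ones N) ?mean_scale_ones//.
      by apply/matrixP => i j; rewrite !mxE !mulr1.
    (* All coordinates of the base point equal [xs], so the common factor [f'(xs)] comes out of the
       mean. *)
    + have := is_diff_mean_map (X := xs *: ones N) (fun j => df _).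
      congr (is_diff_def _ _ _); apply/funext => v; rewrite /mean [RHS]mulrCA.
      by congr (_ * _); rewrite mulr_sumr; apply: eq_bigr => j _; rewrite !mxE mulr1.
  - exists (f \o mean); split.
    + by move=> X; rewrite noncommutative_map_ones// mean_scale_ones// -fE.
    + by rewrite /= mXs.
    + have := is_diff_comp_derive1 (is_diff_mean (xs *: ones N)) (df _).
      by rewrite mXs.
have GE : vector_field F alpha =
    fun X => g X *: ones N - alpha *: (X - mean X *: ones N).
  apply/funext => X.
  by rewrite /vector_field mulmxBl mul1mx -mulmxA !Omega1_mulmx gE.
have dG := is_diff_consensus alpha dg; rewrite -GE in dG.
have entry i r : col_jacobian (vector_field F alpha) (xs *: ones N) i r =
    - alpha * (i == r)%:R + N%:R^-1 * (derive1 f xs + alpha).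
  (* The r-th basis vector has mean [1/N], so component [i] of the differential there is
     [f'(xs)/N - alpha (delta_ir - 1/N)]. *)
  rewrite (col_jacobianE dG) !mxE mean_delta eqxx andbT; ring.
split => //.
- by rewrite GE gXs mXs subrr scaler0 scale0r subr0.
- by apply/matrixP => i r; rewrite entry !mxE mulrC; ring.
Qed.
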